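(* In the half plane $\mathrm{Re}(s)>\max(1,\sigma_c)$, we have \begin{equation*} (\zeta(s)-1)\varphi(s)^2+\zeta(s)\varphi(s)-\zeta(s)(\zeta(s)-1)=0. \end{equation*}
   Context: For $m,k\in\mathbf{N}$ let $\alpha_k(m)$ be the number of $k$-tuples $(m_1,\dots,m_k)$ of integers $m_i\geq 2$ with $m_1m_2\cdots m_k=m$. Define integers $b_n$ recursively by $b_0=b_1=1$ and $b_n+\sum_{i,j\geq 1,\ i+j=n}b_ib_j=0$ for $n\geq 2$. Let $$a_n=\alpha_1(n)+\sum_{\ell\geq 4}(-1)^\ell\alpha_{\ell-1}(n)\sum_{k=2}^{\lfloor \ell/2\rfloor}b_k\binom{\ell-k-2}{k-2},$$ (with $\binom{a}{b}=0$ unless $a\geq b\geq 0$) and let $\varphi(s)=\sum_{n=1}^\infty a_nn^{-s}$, with abscissa of conditional convergence $\sigma_c$. Here $\zeta(s)$ is the Riemann zeta function. *)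

(* Defs.v *)
From HB Require Import structures.
From mathcomp Require Import all_boot all_order all_algebra.
From mathcomp Require Import all_classical all_reals all_analysis.
From mathcomp Require Import complex.
Set Implicit Arguments. Unset Strict Implicit. Unset Printing Implicit Defensive.
Import Order.TTheory GRing.Theory Num.Theory.
Import numFieldNormedType.Exports.
Local Open Scope ring_scope.
Local Open Scope complex_scope.

(** Topological / normed structure on R[i]: the canonical one of a
    numClosedFieldType (copied from the regular module R[i]^o, as
    MathComp-Analysis does generically in normed_module.v). *)
Section ComplexNormed.
Variable R : rcfType.
HB.instance Definition _ := GRing.ComAlgebra.copy R[i] R[i]^o.
HB.instance Definition _ := NormedModule.copy R[i] R[i]^o.
End ComplexNormed.

(** alpha k m = number of k-tuples (m_1,..,m_k) of integers m_i >= 2 with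
    m_1 * ... * m_k = m.  Any such m_i divides m hence (for m >= 1) lies in
    [0, m]; for m = 0 there is no such tuple either way.  So counting tuples
    with entries in 'I_(m.+1) counts all of them. *)
Definition alpha (k m : nat) : nat :=
  #|[set t : k.-tuple 'I_m.+1 |
      all (fun x : 'I_m.+1 => 2 <= x)%N t && (\prod_(x <- t) (x : nat) == m)%N]|.

(** a_n, given the sequence b.  The sum over l >= 4 is finite: alpha (l-1) n
    vanishes as soon as 2^(l-1) > n, in particular for l >= n.+2; we sum over
    4 <= l < n.+2. *)
Definition a_coef (b : nat -> int) (n : nat) : int :=
  (alpha 1 n)%:Z +
  \sum_(4 <= l < n.+2)
     (-1) ^+ l * (alpha l.-1 n)%:Z *
     \sum_(2 <= k < (l./2).+1) b k * ('C(l - k - 2, k - 2))%:Z.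

(** n^{-s} for a positive integer n and complex s, i.e.
    exp(-s log n) = n^{-complex.Re s} (cos(complex.Im s log n) - i sin(complex.Im s log n)). *)
Definition npow_neg (R : realType) (n : nat) (s : R[i]) : R[i] :=
  let L : R := ln (n%:R : R) in
  let mod : R := expR (- (complex.Re s * L)) in
  let th : R := complex.Im s * L in
  Complex (mod * cos th) (- (mod * sin th)).

Definition dirichlet_psum (R : realType) (c : nat -> R[i]) (s : R[i]) : nat -> R[i] :=
  series (fun k => c k.+1 * npow_neg k.+1 s).

(** Value of the Dirichlet series (a limit; meaningful where it converges). *)
Definition dirichlet (R : realType) (c : nat -> R[i]) (s : R[i]) : R[i] :=
  limn (dirichlet_psum c s).

Definition abscissa_cc (R : realType) (c : nat -> R[i]) : \bar R :=
  ereal_inf [set (complex.Re s)%:E | s in [set s : R[i] | cvgn (dirichlet_psum c s)]].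

Definition zeta (R : realType) (s : R[i]) : R[i] := dirichlet (fun _ => 1) s.

(* Main.v *)
Require Import Defs.
From HB Require Import structures.
From mathcomp Require Import all_boot all_order all_algebra.
From mathcomp Require Import all_classical all_reals all_analysis.
From mathcomp Require Import complex.
From mathcomp Require Import zify ring lra.
Set Implicit Arguments. Unset Strict Implicit. Unset Printing Implicit Defensive.
Import Order.TTheory GRing.Theory Num.Theory.
Import numFieldNormedType.Exports.
Local Open Scope ring_scope.

(** Put y = zeta - 1.  Since B(x) = \sum_(k >= 1) b_k x^k satisfies
    B + B^2 = x, the power series F(y) = (1 + y) / y * B (y^2 / (1 + y)) has
    y F^2 + (1 + y) F = y (1 + y); its coefficients are those in the definition
    of a_n, so the identity holds between formal Dirichlet series, in the form
    (y * phi + zeta) * phi = zeta * y.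
    At a point s of the half plane phi converges, possibly conditionally, and
    zeta converges absolutely, so that y * phi + zeta converges to the expected
    value (Mertens).  The remaining product of two convergent Dirichlet series is
    summable by logarithmic means to the product of the sums, and so is
    zeta * y; as both have the same coefficients, the two limits agree.  In this
    way no analytic continuation is needed. *)

(** * Coefficients *)

Lemma sum_dvdn (V : nmodType) (N d : nat) (f : nat -> V) : (0 < d)%N ->
  \sum_(1 <= n < N.+1 | (d %| n)%N) f (n %/ d)%N =
  \sum_(1 <= m < (N %/ d).+1) f m.
Proof.
move=> d0; elim: N => [|N IH]; first by rewrite div0n !big_geq.
rewrite big_mkcond big_nat_recr //= -big_mkcond /= IH divnS //.
by case: (d %| N.+1)%N; rewrite ?addr0 // add1n [in RHS]big_nat_recr.
Qed.

(** Both sides run over the pairs with [2 <= d] and [d * m <= N], grouped on the left by the product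
    and on the right by [d]. *)
Lemma sum_divisors (V : nmodType) (N : nat) (f : nat -> nat -> V) :
  \sum_(1 <= n < N.+1) \sum_(2 <= d < n.+1 | (d %| n)%N) f d (n %/ d)%N =
  \sum_(2 <= d < N.+1) \sum_(1 <= m < (N %/ d).+1) f d m.
Proof.
transitivity (\sum_(1 <= n < N.+1) \sum_(2 <= d < N.+1 | (d %| n)%N)
                f d (n %/ d)%N).
  apply: eq_big_nat => n /andP[n1 nN].
  rewrite (big_nat_widen _ _ _ _ _ nN) /=.
  apply: eq_bigl => d; case dn: (d %| n)%N => //=.
  by rewrite ltnS dvdn_leq.
rewrite (exchange_big_dep_nat xpredT) //=.
by apply: eq_big_nat => d /andP[d2 _]; rewrite sum_dvdn // ltnW.
Qed.

(** In [alpha] the bound on the entries is tied to [m], but removing one factor replaces [m] by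
    [m %/ d]. The bound [M] is therefore kept as a separate parameter. *)
Definition tuple_count k M m :=
  #|[set t : k.-tuple 'I_M |
      all (fun x : 'I_M => 2 <= x)%N t && (\prod_(x <- t) (x : nat) == m)%N]|.

Lemma tuple_countE k M m : tuple_count k M m =
  (\sum_(t : k.-tuple 'I_M)
     (all (fun x : 'I_M => 2 <= x) t && (\prod_(x <- t) (x : nat) == m)))%N.
Proof. by rewrite /tuple_count -sum1dep_card [LHS]big_mkcond. Qed.

Lemma tuple_count0 M m : tuple_count 0 M m = (m == 1)%N.
Proof.
rewrite tuple_countE (bigD1 [tuple]) //= big_nil eq_sym big1 ?addn0 // => t.
by case/eqP; rewrite tuple0.
Qed.

(** Split off the head [d] of the tuple; [m < M] guarantees that every divisor of [m] is available
    as an entry. *)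
Lemma tuple_countS k M m : (0 < m < M)%N -> tuple_count k.+1 M m =
  (\sum_(2 <= d < m.+1 | d %| m) tuple_count k M (m %/ d))%N.
Proof.
case/andP=> m0 mM; rewrite (big_nat_widen _ _ _ _ _ mM) /=.
rewrite tuple_countE.
rewrite (reindex (fun p : 'I_M * k.-tuple 'I_M => cons_tuple p.1 p.2)) /=;
  last first.
  exists (fun t => (thead t, behead_tuple t)).
    by case=> x t _; congr (_, _); apply: val_inj.
  by move=> t _; rewrite [t in RHS]tuple_eta; apply: val_inj.
rewrite -(pair_bigA _ (fun (x : 'I_M) (t : k.-tuple 'I_M) =>
  ((1 < x) && all (fun x : 'I_M => 1 < x) t &&
   (\prod_(y <- x :: t) (y : nat) == m))%N : nat)) /=.
rewrite big_geq_mkord /=.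
rewrite [RHS]big_mkcond /=; apply: eq_bigr => x _.
case: ifP => [/andP[/andP[xm _] x2]|xF].
  rewrite tuple_countE; apply: eq_bigr => t _.
  rewrite x2 big_cons /=; congr (nat_of_bool (_ && _)).
  by rewrite -{1}(divnK xm) mulnC eqn_pmul2r // ltnW.
(* A head at least 2 outside the range of the divisor sum starts no tuple: if the product were [m],
   it would divide [m] and be at most [m]. *)
apply: big1 => t _; rewrite big_cons; case x2: (1 < x)%N => //=.
case: eqP => [E|]; last by rewrite andbF.
move: xF; rewrite x2 -E dvdn_mulr //= ltnS.
by rewrite E (dvdn_leq m0) // -E dvdn_mulr.
Qed.

Lemma tuple_count_indep k M M' m : (0 < m < M)%N -> (m < M')%N ->
  tuple_count k M m = tuple_count k M' m.
Proof.
elim: k m => [|k IH] m /andP[m0 mM] mM'; first by rewrite !tuple_count0.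
rewrite !tuple_countS ?m0 //; apply: congr_big_nat => // d /andP[dm /andP[d2 _]].
have le := leq_div m d.
by rewrite IH ?divn_gt0 ?(leq_ltn_trans le) ?(dvdn_leq m0) ?andbT // ltnW.
Qed.

Lemma alpha0 m : alpha 0 m = (m == 1)%N.
Proof. exact: tuple_count0. Qed.

Lemma alphaS k m : (0 < m)%N ->
  alpha k.+1 m = (\sum_(2 <= d < m.+1 | d %| m) alpha k (m %/ d))%N.
Proof.
move=> m0; rewrite [LHS](@tuple_countS _ m.+1) ?m0 //=.
apply: congr_big_nat => // d /andP[dm /andP[d2 _]].
have d0 : (0 < d)%N by exact: ltnW.
by apply: tuple_count_indep; rewrite ?divn_gt0 ?(dvdn_leq m0) //= ltnS leq_div.
Qed.

(** Every factor at least halves what remains of [m], so more than [m] factors cannot fit. This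
    makes all sums over the number of factors finite. *)
Lemma alpha_gt k m : (0 < m < k)%N -> alpha k m = 0%N.
Proof.
elim: k m => [|k IH] m /andP[m0 mk]; first by [].
rewrite alphaS // big_nat_cond big1 // => d /andP[/andP[d2 dm] dv].
by rewrite IH // divn_gt0 ?(dvdn_leq m0) ?(leq_trans (ltn_Pdiv _ _)) // ltnW.
Qed.

Lemma alpha1 m : (0 < m)%N -> alpha 1 m = (1 < m)%N.
Proof.
move=> m0; rewrite alphaS //.
rewrite (eq_bigr (fun d => (d == m) : nat)); last first.
  move=> d dm; rewrite alpha0; congr nat_of_bool.
  apply/eqP/eqP => [E|->]; last by rewrite divnn m0.
  by rewrite -(divnK dm) E mul1n.
case: ltnP => [m1|m1]; last by rewrite big_geq // ltnS.
rewrite big_mkcond big_nat_recr //= dvdnn eqxx big_nat_cond big1 //.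
by move=> d /andP[/andP[_ dm] _]; rewrite ltn_eqF // if_same.
Qed.

(** * Polynomials in Y under Dirichlet convolution, tested against functions *)

Section DirichletPairing.
Variables (V : comNzRingType).
Implicit Types (g : nat -> V) (p q : {poly int}).

(* The image of p(Y) in the ring of arithmetic functions, Y being the
   indicator function of [2, oo). *)
Definition factor_poly p n : int := \sum_(l < n.+1) p`_l * (alpha l n)%:Z.

Definition alpha_pairing N g k : V :=
  \sum_(1 <= n < N.+1) (alpha k n)%:R * g n.

Definition vanish_above N g := forall n, (N < n)%N -> g n = 0.

Lemma vanish_dilate N g d : (0 < d)%N -> vanish_above N g ->
  vanish_above N (fun n => g (d * n)%N).
Proof. by move=> d0 gN n nN; rewrite gN // (leq_trans nN) // leq_pmull. Qed.

Lemma alpha_pairing0 N g : (0 < N)%N -> alpha_pairing N g 0 = g 1%N.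
Proof.
move=> N0; rewrite /alpha_pairing big_ltn // alpha0 eqxx mul1r.
rewrite big_nat_cond big1 ?addr0 // => n /andP[/andP[n2 _] _].
by rewrite alpha0 gtn_eqF // mul0r.
Qed.

Lemma alpha_pairingS N g k : vanish_above N g ->
  alpha_pairing N g k.+1 =
  \sum_(2 <= d < N.+1) alpha_pairing N (fun n => g (d * n)%N) k.
Proof.
move=> gN; rewrite /alpha_pairing.
transitivity (\sum_(1 <= n < N.+1) \sum_(2 <= d < n.+1 | (d %| n)%N)
   ((alpha k (n %/ d))%:R * g (d * (n %/ d))%N)).
  apply: eq_big_nat => n /andP[n0 _]; rewrite alphaS // natr_sum mulr_suml.
  by apply: eq_bigr => d dn; rewrite mulnC divnK.
rewrite (@sum_divisors _ N (fun d m => (alpha k m)%:R * g (d * m)%N)).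
apply: eq_big_nat => d /andP[d2 dN].
have d0 : (0 < d)%N by exact: ltnW.
rewrite (@big_cat_nat _ _ _ (N %/ d).+1 1 N.+1) //=; last by rewrite ltnS leq_div.
rewrite [X in _ = _ + X]big_nat_cond [X in _ = _ + X]big1 ?addr0 //.
move=> n /andP[/andP[nd _] _]; rewrite gN ?mulr0 //.
by rewrite mulnC -ltn_divLR.
Qed.

(** This is the convolution identity between powers of Y, tested against [g]. As [g] vanishes above
    [N], both variables may run freely up to [N]. The induction peels off one factor [d] and
    replaces [g] by its dilate. *)
Lemma alpha_pairingD N g i j : (0 < N)%N -> vanish_above N g ->
  alpha_pairing N g (i + j)%N =
  \sum_(1 <= m < N.+1) \sum_(1 <= n < N.+1)
     (alpha i m)%:R * (alpha j n)%:R * g (m * n)%N.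
Proof.
move=> N0; elim: i g => [|i IH] g gN.
  transitivity (alpha_pairing N (fun m => alpha_pairing N (fun n => g (m * n)%N) j) 0).
    by rewrite alpha_pairing0 //; apply: eq_bigr => n _; rewrite mul1n.
  apply: eq_bigr => m _; rewrite mulr_sumr; apply: eq_bigr => n _.
  by rewrite mulrA.
rewrite addSn alpha_pairingS //.
transitivity (alpha_pairing N
  (fun m => alpha_pairing N (fun n => g (m * n)%N) j) i.+1); last first.
  apply: eq_bigr => m _; rewrite mulr_sumr; apply: eq_bigr => n _.
  by rewrite mulrA.
rewrite alpha_pairingS; last first.
  move=> m mN; rewrite /alpha_pairing big_nat_cond big1 // => n /andP[/andP[n0 _] _].
  by rewrite gN ?mulr0 // (leq_trans mN) // leq_pmulr.
apply: eq_big_nat => d /andP[d2 _].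
rewrite IH; last by apply: vanish_dilate => //; exact: ltnW.
apply: eq_bigr => m _; rewrite mulr_sumr; apply: eq_bigr => n _.
by rewrite mulnA mulrA.
Qed.

Lemma factor_polyE N p n : (0 < n <= N)%N ->
  factor_poly p n = \sum_(l < N.+1) p`_l * (alpha l n)%:Z.
Proof.
move=> /andP[n0 nN]; rewrite /factor_poly.
rewrite -(big_mkord xpredT (fun l => p`_l * (alpha l n)%:Z)).
rewrite -[RHS](big_mkord xpredT (fun l => p`_l * (alpha l n)%:Z)).
rewrite [RHS](@big_cat_nat _ _ _ n.+1) //= [X in _ = _ + X]big_nat_cond.
rewrite [X in _ = _ + X]big1 ?addr0 // => l /andP[/andP[nl _] _].
by rewrite alpha_gt ?mulr0 // n0.
Qed.

(** Only the coefficients up to degree [N] enter, so polynomials congruent modulo ['X^N.+1] have the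
    same pairing. *)
Definition poly_pairing N g p : V :=
  \sum_(l < N.+1) (p`_l)%:~R * alpha_pairing N g l.

Lemma alpha_pairing_gt N g k : (N < k)%N -> alpha_pairing N g k = 0.
Proof.
move=> Nk; rewrite /alpha_pairing big_nat_cond big1 // => n /andP[/andP[n0 nN] _].
by rewrite alpha_gt ?mul0r // n0 (leq_trans nN).
Qed.

(** Substituting Y for the variable turns the product of polynomials into Dirichlet convolution.
    Both sides are brought to a double sum over the exponents [i] and [j]. *)
Lemma poly_pairingM N g p q : (0 < N)%N -> vanish_above N g ->
  poly_pairing N g (p * q) = \sum_(1 <= m < N.+1) \sum_(1 <= n < N.+1)
    (factor_poly p m)%:~R * (factor_poly q n)%:~R * g (m * n)%N.
Proof.
move=> N0 gN.
transitivity (\sum_(i < N.+1) \sum_(j < N.+1)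
    (p`_i * q`_j)%:~R * alpha_pairing N g (i + j)); last first.
  under [LHS]eq_bigr do under eq_bigr do rewrite alpha_pairingD // mulr_sumr.
  under [LHS]eq_bigr do rewrite exchange_big /=.
  rewrite exchange_big /=; apply: eq_big_nat => m mN.
  under [LHS]eq_bigr do under eq_bigr do rewrite mulr_sumr.
  under [LHS]eq_bigr do rewrite exchange_big /=.
  rewrite exchange_big /=; apply: eq_big_nat => n nN.
  rewrite (factor_polyE _ mN) (factor_polyE _ nN) !rmorph_sum /= mulr_suml mulr_suml.
  apply: eq_bigr => i _; rewrite mulr_sumr mulr_suml; apply: eq_bigr => j _.
  rewrite !rmorphM /=; ring.
rewrite /poly_pairing; under eq_bigr do rewrite coefM rmorph_sum mulr_suml.
transitivity (\sum_(l < N.+1) \sum_(i < N.+1 | (i <= l)%N)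
   (p`_i * q`_(l - i))%:~R * alpha_pairing N g l).
  apply: eq_bigr => l _.
  by rewrite (big_ord_widen_cond N.+1 xpredT
    (fun i => (p`_i * q`_(l - i))%:~R * alpha_pairing N g l)).
rewrite (exchange_big_dep xpredT) //=; apply: eq_bigr => i _.
have iN : (i <= N.+1)%N by rewrite ltnW.
rewrite -(big_geq_mkord i N.+1 (fun=> true)
   (fun l => (p`_i * q`_(l - i))%:~R * alpha_pairing N g l)).
rewrite -[X in \sum_(X <= _ < _) _]add0n big_addn.
rewrite -[RHS](big_mkord xpredT (fun j => (p`_i * q`_j)%:~R * alpha_pairing N g (i + j))).
rewrite [RHS](@big_cat_nat _ _ _ (N.+1 - i)) ?leq_subr //=.
(* The exponents with [i + j > N] contribute nothing, by [alpha_pairing_gt]. *)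
rewrite [X in _ = _ + X]big_nat_cond [X in _ = _ + X]big1 ?addr0 => [|j].
  by apply: eq_bigr => j _; rewrite addnK addnC.
case/andP=> /andP[jN _] _; rewrite alpha_pairing_gt ?mulr0 //.
by rewrite -leq_subLR.
Qed.
End DirichletPairing.

Lemma factor_polyD p q n :
  factor_poly (p + q) n = factor_poly p n + factor_poly q n.
Proof.
by rewrite /factor_poly -big_split; apply: eq_bigr => l _; rewrite coefD mulrDl.
Qed.

Lemma factor_poly1 n : factor_poly 1 n = (n == 1)%N.
Proof.
rewrite /factor_poly big_ord_recl coef1 mul1r alpha0 big1 ?addr0 // => l _.
by rewrite coef1 mul0r.
Qed.

Lemma factor_polyXM p n : (0 < n)%N -> factor_poly ('X * p) n =
  \sum_(2 <= d < n.+1 | (d %| n)%N) factor_poly p (n %/ d).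
Proof.
move=> n0; have nn : (0 < n <= n.+1)%N by rewrite n0 leqnSn.
rewrite (factor_polyE _ nn) big_ord_recl coefXM mul0r add0r.
transitivity (\sum_(l < n.+1) \sum_(2 <= d < n.+1 | (d %| n)%N)
    p`_l * (alpha l (n %/ d))%:Z).
  apply: eq_bigr => l _; rewrite coefXM /= -mulr_sumr alphaS //.
  by rewrite -natz natr_sum; congr (_ * _); apply: eq_bigr => d _; rewrite natz.
rewrite exchange_big /=; apply: congr_big_nat => // d /andP[dn /andP[d2 _]].
rewrite (@factor_polyE n) // leq_div andbT divn_gt0 ?(dvdn_leq n0) //.
by rewrite ltnW.
Qed.

Lemma factor_polyX n : (0 < n)%N -> factor_poly 'X n = (1 < n)%N.
Proof.
move=> n0; rewrite -['X]mulr1 factor_polyXM // -alpha1 // alphaS //.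
rewrite -natz natr_sum; apply: eq_bigr => d _.
by rewrite factor_poly1 alpha0 natz.
Qed.

(** * Congruence modulo a power of X and the truncated inverse of 1 + X *)

Definition eq_coef_lt M (p q : {poly int}) := forall l, (l < M)%N -> p`_l = q`_l.

Lemma eq_coef_ltM M p1 p2 q1 q2 : eq_coef_lt M p1 p2 -> eq_coef_lt M q1 q2 ->
  eq_coef_lt M (p1 * q1) (p2 * q2).
Proof.
move=> hp hq l lM; rewrite !coefM; apply: eq_bigr => i _.
by rewrite hp ?hq // (leq_ltn_trans _ lM) ?leq_subr // -ltnS.
Qed.

Definition alt_geom M : {poly int} := \sum_(j < M) (- 'X) ^+ j.

Lemma alt_geomP M : eq_coef_lt M ((1 + 'X) * alt_geom M) 1.
Proof.
move=> l lM; rewrite /alt_geom.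
have -> : (1 + 'X) * \sum_(j < M) (- 'X) ^+ j = 1 - (- 'X) ^+ M :> {poly int}.
  by rewrite -[RHS]opprB subrX1 -mulNr opprB opprK.
rewrite coefB exprNn -[(-1) ^+ M]/((-1) ^+ M : {poly int}) -signr_odd.
by case: (odd M); rewrite ?expr0 ?expr1 ?mul1r ?mulN1r ?coefN coefXn ltn_eqF // ?oppr0 subr0.
Qed.

Lemma coef_alt_geom M j : (j < M)%N -> (alt_geom M)`_j = (-1) ^+ j.
Proof.
elim: j => [|j IH] jM; have := alt_geomP jM; rewrite mulrDl mul1r coefD coefXM.
  by rewrite /= addr0 coef1.
rewrite /= coef1 /= (IH (ltnW jM)) => E; rewrite exprS mulN1r.
by apply/eqP; rewrite -addr_eq0 E.
Qed.

Lemma alt_geomX M k : eq_coef_lt M ((1 + 'X) * alt_geom M ^+ k.+1) (alt_geom M ^+ k).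
Proof.
rewrite exprS mulrA -[X in eq_coef_lt _ _ X]mul1r.
by apply: eq_coef_ltM => //; exact: alt_geomP.
Qed.

(** This is the negative binomial series. Comparing coefficients in [alt_geomX] gives a recursion in
    [k] and [j] which is Pascal's rule up to sign. *)
Lemma coef_alt_geomX M k j : (j < M)%N ->
  (alt_geom M ^+ k.+1)`_j = (-1) ^+ j * 'C(k + j, k)%:Z.
Proof.
elim: k j => [|k IHk] j jM; first by rewrite expr1 coef_alt_geom // bin0 mulr1.
elim: j jM => [|j IHj] jM; have := alt_geomX k.+1 jM;
  rewrite mulrDl mul1r coefD coefXM IHk //=.
  by rewrite !addn0 !binn addr0.
rewrite (IHj (ltnW jM)) => /(canRL (addrK _)) ->.
rewrite (addSnnS k j) addSn binS PoszD exprS.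
by rewrite mulN1r !mulNr mulrDr opprD addrC.
Qed.

Lemma sum_triangle (V : nmodType) N (f : nat -> nat -> V) :
  (forall i j, (N < i + j)%N -> f i j = 0) ->
  \sum_(1 <= i < N.+1) \sum_(1 <= j < N.+1) f i j =
  \sum_(2 <= n < N.+1) \sum_(1 <= i < n) f i (n - i)%N.
Proof.
move=> f0.
transitivity (\sum_(1 <= i < N.+1) \sum_(2 <= n < N.+1 | (i < n)%N) f i (n - i)%N).
  apply: eq_big_nat => i /andP[i1 iN].
  transitivity (\sum_(i.+1 <= n < N.+1) f i (n - i)%N); last first.
    by rewrite (@big_nat_widenl _ _ _ i.+1 2).
  rewrite (@big_cat_nat _ _ _ (N.+1 - i)) /=; [|lia|lia].
  rewrite [X in _ + X]big_nat_cond [X in _ + X]big1 ?addr0 => [|j jN]; last first.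
    by apply: f0; lia.
  rewrite -(add1n i) big_addn; apply: eq_bigr => j _.
  by rewrite addnK.
rewrite (exchange_big_dep_nat xpredT) //=; apply: eq_big_nat => n nN.
rewrite [RHS](@big_nat_widen _ _ _ _ _ N.+1); last by lia.
by [].
Qed.

(** * The quadratic equation for the generating polynomial of the coefficients *)

Section GeneratingPolynomial.
Variables (b : nat -> int) (hb1 : b 1%N = 1)
  (hb : forall n : nat, (2 <= n)%N ->
          b n + \sum_(1 <= i < n) b i * b (n - i)%N = 0).

(* Truncation of (1 + X) / X * B(X^2 / (1 + X)), where B(x) = \sum_k b_k x^k
   satisfies B + B^2 = x. *)
Definition gen_poly N : {poly int} :=
  \sum_(1 <= k < N.+1) b k *: ('X^(k.*2.-1) * alt_geom N.+1 ^+ k.-1).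

(** In ['X * F * F] the terms [i] and [j] multiply to [b i * b j] times [H (i + j)], while in
    [(1 + 'X) * F] the term [n >= 2] is congruent to [b n] times [H n]. The recursion for [b] thus
    cancels every [H n], and the term [n = 1] leaves the right-hand side. *)
Lemma gen_polyP N : (0 < N)%N ->
  eq_coef_lt N.+1 (('X * gen_poly N + (1 + 'X)) * gen_poly N) ((1 + 'X) * 'X).
Proof.
move=> N0; set P := alt_geom N.+1; set M := N.+1.
pose H n : {poly int} := 'X^(n.*2.-1) * P ^+ n.-2.
have -> : ('X * gen_poly N + (1 + 'X)) * gen_poly N =
  'X * gen_poly N * gen_poly N + (1 + 'X) * gen_poly N by rewrite mulrDl.
have -> : 'X * gen_poly N * gen_poly N =
  \sum_(1 <= i < N.+1) \sum_(1 <= j < N.+1) (b i * b j) *: H (i + j)%N.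
  rewrite [X in _ * X = _]/gen_poly mulr_sumr; apply: eq_big_nat => i /andP[i1 _].
  rewrite /gen_poly mulr_sumr mulr_suml; apply: eq_big_nat => j /andP[j1 _].
  rewrite -!scalerAr -scalerAl scalerA; congr (_ *: _).
  rewrite /H (_ : (i + j).*2.-1 = 1 + j.*2.-1 + i.*2.-1)%N; last by lia.
  rewrite (_ : (i + j).-2 = j.-1 + i.-1)%N; last by lia.
  rewrite !exprD expr1; ring.
have -> : (1 + 'X) * gen_poly N = (1 + 'X) * 'X +
   \sum_(2 <= n < N.+1) b n *: ((1 + 'X) * ('X^(n.*2.-1) * P ^+ n.-1)).
  rewrite /gen_poly big_ltn // hb1 scale1r expr0 mulr1 mulrDr expr1; congr (_ + _).
  by rewrite mulr_sumr; apply: eq_bigr => n _; rewrite -scalerAr.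
move=> l lM; rewrite addrCA [LHS]coefD -[RHS]addr0; congr (_ + _).
rewrite coefD !coef_sum.
under eq_bigr do rewrite coef_sum.
(* For [i + j > N] the power of ['X] in [H (i + j)] already exceeds [N]. *)
rewrite (@sum_triangle _ N (fun i j => ((b i * b j) *: H (i + j)%N)`_l)) //; last first.
  by move=> i j ij; rewrite coefZ coefXnM ifT ?mulr0 //; lia.
rewrite -big_split /= big_nat_cond big1 // => n /andP[/andP[n2 nN] _].
have -> : (b n *: ((1 + 'X) * ('X^(n.*2.-1) * P ^+ n.-1)))`_l = b n * (H n)`_l.
  rewrite coefZ; congr (_ * _); rewrite mulrCA.
  have [k ->] : exists k, n = k.+2 by exists n.-2; lia.
  by apply: eq_coef_ltM (lM) => //; exact: alt_geomX.
transitivity ((b n + \sum_(1 <= i < n) b i * b (n - i)%N) * (H n)`_l); last first.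
  by rewrite hb // mul0r.
rewrite addrC mulrDl; congr (_ + _); rewrite mulr_suml; apply: eq_big_nat => i /andP[i1 iN].
by rewrite coefZ subnKC // ltnW.
Qed.

Lemma coef_gen_poly N l : (l <= N)%N -> (gen_poly N)`_l = (l == 1)%:Z +
  (-1) ^+ l.+1 * \sum_(2 <= k < (l.+1./2).+1) b k * ('C(l.+1 - k - 2, k - 2))%:Z.
Proof.
move=> lN; case: (posnP N) => [N0|N0].
  have -> : l = 0%N by lia.
  by rewrite /gen_poly N0 !big_geq // coef0 mulr0.
rewrite /gen_poly big_ltn // coefD hb1 scale1r expr0 mulr1 coefXn; congr (_ + _).
  by rewrite /=; case: (l == 1)%N.
rewrite coef_sum mulr_sumr [RHS](@big_nat_widen _ _ _ _ _ N.+1); last by lia.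
rewrite [RHS]big_mkcond /=; apply: eq_big_nat => k /andP[k2 kN].
(* The power ['X^(k.*2.-1)] reaches degree [l] exactly when [k <= l.+1./2], so the mixed cases are
   contradictory. *)
rewrite coefZ coefXnM; case: ifP => h1; case: ifP => h2; try lia.
have [j kj] : exists j, k = j.+2 by exists k.-2; lia.
rewrite kj /= coef_alt_geomX; last by lia.
rewrite mulrCA; congr (_ * (_ * _)).
  (* The exponents [l - (2k - 1)] and [l + 1] have the same parity. *)
  rewrite -signr_odd -[in RHS]signr_odd; congr (_ ^+ (nat_of_bool _)); lia.
by congr (Posz 'C(_, _)); lia.
Qed.

Lemma a_coefE N n : (0 < n <= N)%N -> a_coef b n = factor_poly (gen_poly N) n.
Proof.
move=> /andP[n0 nN]; rewrite /factor_poly.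
rewrite -(big_mkord xpredT (fun l => (gen_poly N)`_l * (alpha l n)%:Z)).
rewrite (eq_big_nat _ _ (F2 := fun l => (l == 1)%:Z * (alpha l n)%:Z +
  (-1) ^+ l.+1 * (\sum_(2 <= k < (l.+1./2).+1)
     b k * ('C(l.+1 - k - 2, k - 2))%:Z) * (alpha l n)%:Z)); last first.
  by move=> l lN; rewrite coef_gen_poly ?mulrDl //; lia.
rewrite big_split /=; congr (_ + _).
  rewrite big_ltn // mul0r add0r big_ltn // mul1r big_nat_cond big1 ?addr0 //.
  by move=> l /andP[/andP[l2 _] _]; rewrite gtn_eqF // mul0r.
(* The index in [a_coef] is one more than the degree. Below 4 its inner sum over [k] is empty, so
   the sum may start at 1 and then be shifted. *)
rewrite (@big_nat_widenl _ _ _ 4 1) //.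
rewrite [LHS]big_mkcond /= (big_addn 0 n.+2 1) subn1 /=.
apply: eq_big_nat => l _; rewrite addn1 /=; case: ifP => l3.
  by rewrite mulrAC.
by rewrite [X in _ * X * _]big_geq ?mulr0 ?mul0r //; lia.
Qed.

(** This is the formal identity between [(y * phi + zeta) * phi] and [zeta * y], tested against [g]:
    pair both sides of [gen_polyP] with [g]. *)
Lemma pairing_identity (V : comNzRingType) N (g : nat -> V) :
  (0 < N)%N -> vanish_above N g ->
  \sum_(1 <= m < N.+1) \sum_(1 <= n < N.+1)
    (\sum_(2 <= d < m.+1 | (d %| m)%N) a_coef b (m %/ d) + 1)%:~R *
    (a_coef b n)%:~R * g (m * n)%N =
  \sum_(1 <= m < N.+1) \sum_(1 <= n < N.+1) (1 < n)%N%:R * g (m * n)%N.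
Proof.
move=> N0 gN; set F := gen_poly N.
transitivity (poly_pairing N g (('X * F + (1 + 'X)) * F)).
  rewrite poly_pairingM //; apply: eq_big_nat => m /andP[m0 mN].
  apply: eq_big_nat => n nN; rewrite (@a_coefE N n) //; congr (_%:~R * _ * _).
  rewrite !factor_polyD factor_polyXM // factor_poly1 factor_polyX //.
  (* The polynomial [1 + 'X] becomes the constant function 1, the coefficients of zeta. *)
  congr (_ + _); last by case: (m) m0 => [|[]].
  apply: congr_big_nat => // d /andP[dm /andP[d2 _]].
  have le := leq_div m d.
  rewrite (@a_coefE N) // (leq_trans le) // andbT divn_gt0 ?(dvdn_leq m0) //.
  by rewrite ltnW.
transitivity (poly_pairing N g ((1 + 'X) * 'X)).
  by apply: eq_bigr => l _; rewrite gen_polyP.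
rewrite poly_pairingM //; apply: eq_big_nat => m /andP[m0 mN].
apply: eq_big_nat => n /andP[n0 nN]; rewrite factor_polyD factor_poly1 !factor_polyX //.
rewrite (_ : (m == 1)%:Z + (1 < m)%N%:Z = 1); last by case: (m) m0 => [|[]].
by rewrite mul1r.
Qed.
End GeneratingPolynomial.

(** * Convergence of Dirichlet series *)

Section ComplexAbs.
Variable R : realType.
Implicit Types (z w l : R[i]) (u : nat -> R[i]).

(** The norm of [R[i]] takes its values in [R[i]]; its real part gives access to the total order and
    the comparison tests of [R]. *)
Definition cabs z : R := complex.Re `|z|.

Lemma cabsE z : `|z| = (cabs z)%:C%C.
Proof. by rewrite /cabs normc_def. Qed.

Lemma cabs_ge0 z : 0 <= cabs z.
Proof. by rewrite -lecR -cabsE normr_ge0. Qed.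

Lemma cabs0 : cabs 0 = 0.
Proof. by rewrite /cabs normr0. Qed.

Lemma cabsM z w : cabs (z * w) = cabs z * cabs w.
Proof. by apply: complexI; rewrite rmorphM /= -!cabsE normrM. Qed.

Lemma cabsN z : cabs (- z) = cabs z.
Proof. by rewrite /cabs normrN. Qed.

Lemma cabsD z w : cabs (z + w) <= cabs z + cabs w.
Proof. by rewrite -lecR rmorphD /= -!cabsE ler_normD. Qed.

Lemma cabs_sum (I : Type) (r : seq I) (P : pred I) (F : I -> R[i]) :
  cabs (\sum_(i <- r | P i) F i) <= \sum_(i <- r | P i) cabs (F i).
Proof.
elim/big_ind2: _ => [|x1 x2 y1 y2 hx hy|//]; first by rewrite cabs0.
by rewrite (le_trans (cabsD _ _)) // lerD.
Qed.

Lemma cabs_real (x : R) : 0 <= x -> cabs x%:C%C = x.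
Proof. by move=> x0; apply: complexI; rewrite -cabsE ger0_norm // lecR. Qed.

Lemma cabs_ReIm (x y : R) : cabs (Complex x y) <= `|x| + `|y|.
Proof.
rewrite /cabs normc_def /= -[leRHS]ger0_norm ?addr_ge0 // -sqrtr_sqr.
rewrite ler_wsqrtr // sqrrD !real_normK ?num_real // lerD2r lerDl.
by rewrite mulrn_wge0 // mulr_ge0.
Qed.

Lemma Re_le_cabs z : `|complex.Re z| <= cabs z.
Proof. by rewrite -lecR -cabsE normc_ge_Re. Qed.

Lemma Im_le_cabs z : `|complex.Im z| <= cabs z.
Proof.
case: z => x y; rewrite /cabs normc_def /= -sqrtr_sqr ler_wsqrtr //.
by rewrite lerDr sqr_ge0.
Qed.

Lemma cvg_cabs u l : (u @ \oo --> l)%classic <->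
  ((fun n => cabs (u n - l)) @ \oo --> (0 : R))%classic.
Proof.
split.
  move/cvgrPdistC_lt => ul; apply/cvgr0Pnorm_lt => e e0.
  have eC : (0 : R[i]) < e%:C%C by rewrite ltcR.
  apply: filterS (ul _ eC) => n.
  by rewrite cabsE ltcR ger0_norm ?cabs_ge0.
move/cvgr0Pnorm_lt => ul; apply/cvgrPdistC_lt => e.
rewrite ltcE => /andP[/eqP e1 e0].
apply: filterS (ul _ e0) => n; rewrite ger0_norm ?cabs_ge0 // cabsE => h.
by rewrite ltcE /= e1 eqxx.
Qed.

Lemma cvg_cabs_bounded u l : (u @ \oo --> l)%classic ->
  exists2 M, 0 <= M & forall n, cabs (u n) <= M.
Proof.
move=> /cvg_cabs/cvgP/cvg_seq_bounded/bounded_fun_has_ubound[B uB].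
have uM n : cabs (u n) <= B + cabs l.
  rewrite -[u n](subrK l); apply: le_trans (cabsD _ _) _.
  by rewrite lerD2r; apply: uB; exists n.
by exists (B + cabs l) => //; exact: le_trans (cabs_ge0 _) (uM 0%N).
Qed.

(** The real and imaginary parts are dominated by the modulus, so each converges absolutely in
    [R]. *)
Lemma cabs_series_cvg (t : nat -> R[i]) :
  cvgn (series (fun k => cabs (t k))) -> cvgn (series t).
Proof.
move=> ct.
have cR : cvgn (series (fun k => complex.Re (t k))).
  apply: normed_cvg; apply: series_le_cvg ct => n //=; first exact: cabs_ge0.
  exact: Re_le_cabs.
have cI : cvgn (series (fun k => complex.Im (t k))).
  apply: normed_cvg; apply: series_le_cvg ct => n //=; first exact: cabs_ge0.
  exact: Im_le_cabs.
apply/cvg_ex; exists (Complex (limn (series (fun k => complex.Re (t k))))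
                        (limn (series (fun k => complex.Im (t k))))).
apply/cvg_cabs.
move/cvgrPdist_lt: cR => cR; move/cvgrPdist_lt: cI => cI.
apply/cvgr0Pnorm_lt => e e0; have e2 : 0 < e / 2 by lra.
near=> n; rewrite ger0_norm ?cabs_ge0 //.
set x := limn _; set y := limn _.
have -> : series t n - Complex x y =
  Complex (series (fun k => complex.Re (t k)) n - x)
          (series (fun k => complex.Im (t k)) n - y).
  rewrite /series /=; elim: (index_iota 0 n) => [|k r IH].
    by rewrite !big_nil /=; apply/eqP; rewrite eq_complex /= !sub0r !eqxx.
  rewrite !big_cons -addrA IH; apply/eqP.
  by rewrite eq_complex /= -!addrA; case: (t k) => a b /=; rewrite !eqxx.
apply: le_lt_trans (cabs_ReIm _ _) _; rewrite (splitr e) ltrD //.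
  by rewrite distrC; near: n; exact: cR.
by rewrite distrC; near: n; exact: cI.
Unshelve. all: by end_near. Qed.

End ComplexAbs.

(** * Elementary bounds for sine, cosine and the exponential *)

Section Lipschitz.
Variable R : realType.

Lemma lipschitz1_MVT (f df : R -> R) :
  (forall x, is_derive x (1 : R) f (df x)) -> (forall x, `|df x| <= 1) ->
  forall a b, `|f a - f b| <= `|a - b|.
Proof.
move=> fdf df1 a b; wlog ab : a b / a <= b => [H|].
  by case: (leP a b) => [/H//|/ltW/H]; rewrite distrC (distrC a).
have [|c _] := @MVT_segment _ f df a b ab (fun x _ => fdf x).
  apply: continuous_subspaceT => x.
  by apply: differentiable_continuous; apply/derivable1_diffP; case: (fdf x).
rewrite distrC => ->; rewrite normrM distrC ler_piMl //.
Qed.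

Lemma sin_lipschitz (a b : R) : `|sin a - sin b| <= `|a - b|.
Proof.
apply: (@lipschitz1_MVT _ cos) => x; rewrite ?ler_norml ?cos_geN1 ?cos_le1 //.
Qed.

Lemma cos_lipschitz (a b : R) : `|cos a - cos b| <= `|a - b|.
Proof.
apply: (@lipschitz1_MVT _ (fun x => - sin x)) => x.
by rewrite normrN ler_norml sin_geN1 sin_le1.
Qed.

(** This is [1 + u <= expR u] at [u = x * (b - a)]. With logarithms of consecutive integers for [a]
    and [b], the right-hand side telescopes, which replaces an integral comparison. *)
Lemma expR_decr_bound (x a b : R) : 0 < x ->
  expR (- (x * b)) * (b - a) <= (expR (- (x * a)) - expR (- (x * b))) / x.
Proof.
move=> x0; rewrite ler_pdivlMr //.
have -> : - (x * a) = - (x * b) + x * (b - a) by ring.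
rewrite expRD lerBrDr.
apply: le_trans (_ : expR (- (x * b)) * (1 + x * (b - a)) <= _).
  by rewrite le_eqVlt; apply/orP; left; apply/eqP; ring.
by rewrite ler_wpM2l ?expR_ge0 // expR_ge1Dx.
Qed.
End Lipschitz.

(** * The functions n^(-s) and the half plane of convergence *)

Section NegativePowers.
Variable R : realType.
Implicit Types (s t w : R[i]).

Definition rpow_neg (x : R) (n : nat) : R := expR (- (x * ln n%:R)).

Lemma rpow_neg_ge0 x n : 0 <= rpow_neg x n.
Proof. exact: expR_ge0. Qed.

Lemma npow_negM m n s : (0 < m)%N -> (0 < n)%N ->
  npow_neg (m * n) s = npow_neg m s * npow_neg n s.
Proof.
move=> m0 n0; rewrite /npow_neg natrM lnM ?posrE ?ltr0n //.
rewrite !mulrDr opprD expRD cosD sinD; apply/eqP; rewrite eq_complex /=.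
by apply/andP; split; apply/eqP; ring.
Qed.

Lemma npow_negD n s t : npow_neg n (s + t) = npow_neg n s * npow_neg n t.
Proof.
case: s t => a b [c d]; rewrite /npow_neg /=.
rewrite !mulrDl opprD expRD cosD sinD; apply/eqP; rewrite eq_complex /=.
by apply/andP; split; apply/eqP; ring.
Qed.

Lemma npow_neg1 s : npow_neg 1 s = 1.
Proof.
by rewrite /npow_neg ln1 !mulr0 oppr0 expR0 cos0 sin0 !mulr1 mulr0 oppr0.
Qed.

Lemma cabs_npow_neg n s : cabs (npow_neg n s) = rpow_neg (complex.Re s) n.
Proof.
rewrite /cabs normc_def /= sqrrN !exprMn -mulrDr cos2Dsin2 mulr1.
by rewrite sqrtr_sqr ger0_norm ?expR_ge0.
Qed.

Lemma rpow_neg_decr x n : 0 < x -> (0 < n)%N ->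
  rpow_neg x n.+1 <= rpow_neg x n.
Proof.
move=> x0 n0; rewrite ler_expR lerN2 ler_pM2l // ler_ln ?posrE ?ltr0n //.
by rewrite ler_nat.
Qed.

(** The change of modulus costs one difference; the change of phase, at most [|Im w|] times the
    logarithmic step, is absorbed by [expR_decr_bound]. The factor 2 adds up the real and imaginary
    parts. *)
Lemma npow_neg_diff n w : (0 < n)%N -> 0 < complex.Re w ->
  cabs (npow_neg n w - npow_neg n.+1 w) <=
  2 * (1 + `|complex.Im w| / complex.Re w) *
    (rpow_neg (complex.Re w) n - rpow_neg (complex.Re w) n.+1).
Proof.
case: w => x y n0 /= x0; rewrite /npow_neg /=.
have d0 := rpow_neg_decr x0 n0; rewrite -subr_ge0 in d0.
have ab : ln (n%:R : R) <= ln n.+1%:R.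
  by rewrite ler_ln ?posrE ?ltr0n // ler_nat.
have key := expR_decr_bound (ln n%:R) (ln n.+1%:R) x0.
rewrite -/(rpow_neg x n) -/(rpow_neg x n.+1) in key *.
set a := ln n%:R in ab key *; set b := ln n.+1%:R in ab key *.
set p := rpow_neg x n in key d0 *; set q := rpow_neg x n.+1 in key d0 *.
have q0 : 0 <= q by exact: expR_ge0.
have comp (u v : R) : `|u| <= 1 -> `|u - v| <= `|y * a - y * b| ->
    `|p * u - q * v| <= (1 + `|y| / x) * (p - q).
  move=> u1 uv; have -> : p * u - q * v = (p - q) * u + q * (u - v) by ring.
  apply: le_trans (ler_normD _ _) _; rewrite !normrM (ger0_norm d0) (ger0_norm q0).
  rewrite [leRHS]mulrDl mul1r lerD ?ler_piMr //.
  apply: le_trans (ler_wpM2l q0 uv) _.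
  have -> : `|y * a - y * b| = `|y| * (b - a).
    by rewrite -mulrBr normrM distrC [X in _ * X]ger0_norm ?subr_ge0.
  by rewrite mulrCA -mulrA ler_wpM2l // [leRHS]mulrC.
have -> : Complex (p * cos (y * a)) (- (p * sin (y * a))) -
    Complex (q * cos (y * b)) (- (q * sin (y * b))) =
  Complex (p * cos (y * a) - q * cos (y * b))
          (- (p * sin (y * a) - q * sin (y * b))).
  by apply/eqP; rewrite eq_complex /= opprD !eqxx.
apply: le_trans (cabs_ReIm _ _) _; rewrite normrN -mulrA mulr_natl mulr2n lerD //.
  by apply: comp; [rewrite ler_norml cos_geN1 cos_le1 | exact: cos_lipschitz].
by apply: comp; [rewrite ler_norml sin_geN1 sin_le1 | exact: sin_lipschitz].
Qed.

Lemma cvg_rpow_neg_diff x : 0 < x ->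
  cvgn (series (fun k => rpow_neg x k.+1 - rpow_neg x k.+2)).
Proof.
move=> x0; apply: nondecreasing_is_cvgn.
  by apply: nondecreasing_series => k _ _; rewrite subr_ge0 rpow_neg_decr.
exists 1 => _ [n _ <-]; rewrite /series /=.
rewrite (@telescope_sumr_eq _ 0 n (fun k => - rpow_neg x k.+1)) //; last first.
  by move=> k _; rewrite opprK addrC.
by rewrite opprK addrC lerBlDr {1}/rpow_neg ln1 mulr0 oppr0 expR0 lerDl rpow_neg_ge0.
Qed.

(** Write the left-hand side as the power of exponent [x - 1] times [1 / (k + 2)], bound this
    fraction by [ln (k + 2) - ln (k + 1)], and apply [expR_decr_bound]. *)
Lemma rpow_neg_zeta x k : 1 < x -> rpow_neg x k.+2 <=
  (rpow_neg (x - 1) k.+1 - rpow_neg (x - 1) k.+2) / (x - 1).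
Proof.
move=> x1; have d0 : 0 < x - 1 by rewrite subr_gt0.
apply: le_trans (expR_decr_bound _ _ d0).
have -> : rpow_neg x k.+2 = expR (- ((x - 1) * ln k.+2%:R)) * k.+2%:R^-1.
  rewrite -[in RHS](@lnK _ k.+2%:R) ?posrE ?ltr0n // -expRN expRK -expRD.
  by congr expR; ring.
rewrite ler_wpM2l ?expR_ge0 //.
have k2 : (0 : R) < k.+2%:R by rewrite ltr0n.
have -> : ln (k.+1%:R : R) = ln k.+2%:R + ln (1 + - k.+2%:R^-1).
  have h : 1 + - k.+2%:R^-1 = k.+1%:R / k.+2%:R :> R.
    rewrite (_ : k.+1%:R = k.+2%:R - 1); last by rewrite -[k.+2%:R]natr1 addrK.
    by rewrite mulrBl divff ?gt_eqF // mul1r.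
  by rewrite h ln_div ?posrE ?ltr0n // addrC subrK.
by rewrite opprD addrA subrr add0r lerNr le_ln1Dx // ltrN2 invf_lt1 // ltr1n.
Qed.

Lemma cvg_rpow_neg x : 1 < x -> cvgn (series (fun k => rpow_neg x k.+1)).
Proof.
move=> x1; have d0 : 0 < x - 1 by rewrite subr_gt0.
(* The telescoping bound covers the integers from 2 on, so the first term is set aside. *)
rewrite -(is_cvg_series_restrict 1).
have /cvg_ex[l hl] : cvgn (series (fun k => rpow_neg x k.+2)).
  apply: (@series_le_cvg _ _ ((x - 1)^-1 *:
    (fun k => rpow_neg (x - 1) k.+1 - rpow_neg (x - 1) k.+2))) => [n|n|n|].
  - exact: rpow_neg_ge0.
  - by rewrite mulr_ge0 ?invr_ge0 ?(ltW d0) // subr_ge0 rpow_neg_decr.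
  - by rewrite -[X in _ <= X]mulrC; exact: rpow_neg_zeta.
  - by apply: is_cvg_seriesZ; exact: cvg_rpow_neg_diff.
apply/cvg_ex; exists l; rewrite -cvg_shiftS.
suff -> : (fun n => \sum_(1 <= k < n.+1) rpow_neg x k.+1) =
  series (fun k => rpow_neg x k.+2) by [].
by apply/funext => n; rewrite big_add1.
Qed.
(** Abel summation: the partial sums at [s0] are bounded, and the factors [v k], powers with
    exponent [s - s0], have absolutely summable differences. *)
Lemma cvg_dirichlet_psum (c : nat -> R[i]) s0 s :
  complex.Re s0 < complex.Re s -> cvgn (dirichlet_psum c s0) ->
  cvgn (dirichlet_psum c s).
Proof.
move=> lt_s cS; set S := dirichlet_psum c s0.
set w := s - s0; have w0 : 0 < complex.Re w.
  by move: lt_s; rewrite /w; case: (s) (s0) => [a b] [a' b'] /=; rewrite subr_gt0.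
pose v k : R[i] := npow_neg k.+1 w.
have Sv n : dirichlet_psum c s n = S n * v n +
    series (fun k => S k.+1 * (v k - v k.+1)) n.
  rewrite /dirichlet_psum /series /=.
  elim: n => [|n IH].
    by rewrite !big_geq // /S /dirichlet_psum /series /= big_geq // mul0r addr0.
  rewrite !big_nat_recr //= IH.
  have -> : S n.+1 = S n + c n.+1 * npow_neg n.+1 s0.
    by rewrite /S /dirichlet_psum /series /= big_nat_recr.
  have -> : npow_neg n.+1 s = npow_neg n.+1 s0 * v n.
    by rewrite -npow_negD /w addrC subrK.
  ring.
have /cvg_ex[l Sl] : cvgn S by [].
have [M M0 SM] := cvg_cabs_bounded Sl.
pose C := 2 * (1 + `|complex.Im w| / complex.Re w).
have C0 : 0 <= C by rewrite mulr_ge0 // addr_ge0 // divr_ge0 // ltW.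
have vC k : cabs (v k - v k.+1) <=
    C * (rpow_neg (complex.Re w) k.+1 - rpow_neg (complex.Re w) k.+2).
  exact: npow_neg_diff.
have d0 k : 0 <= rpow_neg (complex.Re w) k.+1 - rpow_neg (complex.Re w) k.+2.
  by rewrite subr_ge0 rpow_neg_decr.
have cv : cvgn v.
  have : cvgn (series (fun k => v k - v k.+1)).
    apply: cabs_series_cvg; apply: (@series_le_cvg _ _
      (C *: (fun k => rpow_neg (complex.Re w) k.+1 -
                      rpow_neg (complex.Re w) k.+2))) => [n|n|n|].
    - exact: cabs_ge0.
    - by rewrite mulr_ge0.
    - exact: vC.
    - by apply: is_cvg_seriesZ; exact: cvg_rpow_neg_diff.
  move=> cs.
  have vE : (fun n => v 0%N - series (fun k => v k - v k.+1) n) = v.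
    apply/funext => n; rewrite /series /=.
    rewrite (@telescope_sumr_eq _ 0 n (fun k => - v k)) //.
      by rewrite opprK; ring.
    by move=> k _; ring.
  by rewrite -vE; apply: cvgP (cvgB (cvg_cst (v 0%N)) cs).
have cs : cvgn (series (fun k => S k.+1 * (v k - v k.+1))).
  apply: cabs_series_cvg; apply: (@series_le_cvg _ _
    ((M * C) *: (fun k => rpow_neg (complex.Re w) k.+1 -
                          rpow_neg (complex.Re w) k.+2))) => [n|n|n|].
  - exact: cabs_ge0.
  - by apply: mulr_ge0; [exact: mulr_ge0 | exact: d0].
  - rewrite cabsM -[X in _ <= X]mulrA.
    exact: ler_pM (cabs_ge0 _) (cabs_ge0 _) (SM _) (vC _).
  - by apply: is_cvg_seriesZ; exact: cvg_rpow_neg_diff.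
rewrite (_ : dirichlet_psum c s = (fun n => S n * v n +
  series (fun k => S k.+1 * (v k - v k.+1)) n)); last exact/funext.
exact: cvgP (cvgD (cvgM Sl cv) cs).
Qed.

End NegativePowers.

(** * Products of Dirichlet series *)

Section LogMean.
Variable R : realType.
Implicit Types (u v : nat -> R[i]).

Definition psum (V : zmodType) (u : nat -> V) n : V := \sum_(1 <= m < n.+1) u m.

Lemma psumE (V : zmodType) (u : nat -> V) : psum u = series (fun k => u k.+1).
Proof. by apply/funext => n; rewrite /psum big_add1. Qed.

Lemma psum_abel (V : comPzRingType) (u h : nat -> V) N :
  psum (fun m => u m * h m) N =
  psum (fun m => psum u m * (h m - h m.+1)) N + psum u N * h N.+1.
Proof.
elim: N => [|N IH]; first by rewrite /psum !big_geq // mul0r addr0.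
rewrite {1}/psum big_nat_recr //= -/(psum _ N) IH.
rewrite [in RHS]/psum big_nat_recr //= -!/(psum _ _).
rewrite (_ : psum u N.+1 = psum u N + u N.+1); first by ring.
by rewrite /psum big_nat_recr.
Qed.

(* As a function of ln n this is t |-> (ln N - t)_+, which is convex. *)
Definition log_kernel N n : R := Num.max 0 (ln N%:R - ln n%:R).

Lemma log_kernel_gt N n : (0 < N <= n)%N -> log_kernel N n = 0.
Proof.
move=> /andP[N0 Nn]; apply/max_idPl; rewrite subr_le0 ler_ln ?posrE ?ltr0n //.
  by rewrite ler_nat.
exact: leq_trans Nn.
Qed.

Lemma log_kernel_le N n : (0 < n <= N)%N -> log_kernel N n = ln N%:R - ln n%:R.
Proof.
move=> /andP[n0 nN]; apply/max_idPr; rewrite subr_ge0 ler_ln ?posrE ?ltr0n //.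
  by rewrite ler_nat.
exact: leq_trans nN.
Qed.

(** The mixed second difference of the kernel at [m * n], which is the weight left on
    [psum u m * psum v n] by Abel summation in both variables. *)
Definition log_weight N m n : R :=
  (log_kernel N (m * n) - log_kernel N (m.+1 * n)) -
  (log_kernel N (m * n.+1) - log_kernel N (m.+1 * n.+1)).

Lemma log_weightC N m n : log_weight N m n = log_weight N n m.
Proof.
by rewrite /log_weight ![(n * _)%N]mulnC ![(n.+1 * _)%N]mulnC; ring.
Qed.

(** The kernel is a convex function of [ln m + ln n], and such a function has nonnegative mixed
    differences. Splitting the four maxima leaves linear inequalities. *)
Lemma log_weight_ge0 N m n : (0 < m)%N -> (0 < n)%N -> 0 <= log_weight N m n.
Proof.
move=> m0 n0; rewrite /log_weight /log_kernel !natrM !lnM ?posrE ?ltr0n //.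
have := @ler_ln R m%:R m.+1%:R; rewrite !posrE !ltr0n ler_nat m0 leqnSn => /(_ isT isT).
have := @ler_ln R n%:R n.+1%:R; rewrite !posrE !ltr0n ler_nat n0 leqnSn => /(_ isT isT).
move: (ln m%:R) (ln m.+1%:R) (ln n%:R) (ln n.+1%:R) (ln N%:R) => a a' b b' x hb ha.
by rewrite /Num.max; do 4!case: ifP => ?; lra.
Qed.

Lemma log_weight_sum N m : (0 < m <= N)%N -> psum (log_weight N m) N =
  log_kernel N m - log_kernel N m.+1.
Proof.
move=> /andP[m0 mN]; have N0 : (0 < N)%N by exact: leq_trans mN.
rewrite /psum /log_weight.
rewrite (@telescope_sumr_eq _ 1 N.+1
  (fun n => - (log_kernel N (m * n) - log_kernel N (m.+1 * n)))) //; last first.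
  by move=> n _; ring.
rewrite !muln1 (@log_kernel_gt N (m * N.+1)) ?(@log_kernel_gt N (m.+1 * N.+1)).
- by rewrite subrr oppr0 add0r opprK.
- by rewrite N0 /= mulSn ltnW // leq_addr.
- by rewrite N0 /= ltnW // leq_pmull.
Qed.

Definition log_step n : R := ln n.+1%:R - ln n%:R.

Lemma log_step_ge0 n : (0 < n)%N -> 0 <= log_step n.
Proof. by move=> n0; rewrite subr_ge0 ler_ln ?posrE ?ltr0n // ler_nat. Qed.

Lemma log_step_sum m n : (m <= n)%N ->
  \sum_(m <= k < n) log_step k = ln n%:R - ln m%:R.
Proof. by move=> mn; rewrite telescope_sumr. Qed.

Lemma near_ln_gt (M : R) : (\forall N \near \oo, M < ln N%:R)%classic.
Proof.
near=> N; apply: (@lt_le_trans _ _ (M + 1)); first by rewrite ltrDl.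
rewrite -[leLHS]expRK ler_ln ?posrE ?expR_gt0 //; last first.
  by rewrite ltr0n; near: N; exact: nbhs_infty_gt.
by near: N; exact: nbhs_infty_ger.
Unshelve. all: by end_near. Qed.

(** The weights [log_step] have total mass [ln N], which tends to infinity: a fixed head becomes
    negligible, and beyond it [r] is small. *)
Lemma log_cesaro (r : nat -> R) : (forall n, 0 <= r n) ->
  (r @ \oo --> (0 : R))%classic ->
  ((fun N => (\sum_(1 <= m < N) r m * log_step m) / ln N%:R) @ \oo --> (0 : R))%classic.
Proof.
move=> r0 /cvgr0Pnorm_lt r_0; apply/cvgr0Pnorm_lt => e e0.
have e2 : 0 < e / 2 by lra.
have [M0 _ rM] := r_0 _ e2; set M := M0.+1.
pose C := \sum_(1 <= m < M) r m * log_step m.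
have sum0 N : 0 <= \sum_(1 <= m < N) r m * log_step m.
  rewrite big_nat_cond sumr_ge0 // => m /andP[/andP[m1 _] _].
  by rewrite mulr_ge0 ?log_step_ge0.
near=> N.
have MN : (M <= N)%N by near: N; exact: nbhs_infty_ge.
have lN : C / (e / 2) < ln N%:R by near: N; exact: near_ln_gt.
have lN0 : 0 < ln N%:R :> R.
  by apply: le_lt_trans lN; rewrite divr_ge0 ?sum0 // ltW.
rewrite ger0_norm ?divr_ge0 ?sum0 ?(ltW lN0) // ltr_pdivrMr //.
rewrite (@big_cat_nat _ _ _ M) //= -/C.
have le2 : \sum_(M <= m < N) r m * log_step m <= e / 2 * ln N%:R.
  apply: le_trans (_ : \sum_(M <= m < N) e / 2 * log_step m <= _).
    rewrite big_nat_cond [leRHS]big_nat_cond ler_sum // => m /andP[/andP[Mm _] _].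
    rewrite ler_wpM2r ?log_step_ge0 ?(leq_trans _ Mm) //.
    by have := rM m (ltnW Mm); rewrite /= ger0_norm // => /ltW.
  rewrite -mulr_sumr log_step_sum // ler_wpM2l ?(ltW e2) // gerBl.
  by rewrite ln_ge0 // ler1n.
move: lN; rewrite ltr_pdivrMr // => lN; lra.
Unshelve. all: by end_near. Qed.

(** Grouped by [k = m * n], this is the sum of the Dirichlet product coefficients times
    [ln N - ln k] over [k <= N]. Divided by [ln N] it is their Riesz logarithmic mean. *)
Definition log_sum u v N : R[i] := \sum_(1 <= m < N.+1) \sum_(1 <= n < N.+1)
  u m * v n * (log_kernel N (m * n))%:C%C.

Lemma log_sumE u v N : (0 < N)%N -> log_sum u v N =
  \sum_(1 <= m < N.+1) \sum_(1 <= n < N.+1)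
    psum u m * psum v n * (log_weight N m n)%:C%C.
Proof.
move=> N0.
transitivity (psum (fun m =>
  u m * psum (fun n => v n * (log_kernel N (m * n))%:C%C) N) N).
  by apply: eq_bigr => m _; rewrite mulr_sumr; apply: eq_bigr => n _; rewrite mulrA.
rewrite psum_abel [X in _ * X]big_nat_cond [X in _ * X]big1 ?mulr0 ?addr0; last first.
  move=> n /andP[/andP[n0 _] _]; rewrite log_kernel_gt ?mulr0 // N0 ltnW //.
  by rewrite leq_pmulr.
apply: eq_big_nat => m /andP[m0 _].
rewrite -sumrB.
rewrite (eq_bigr (fun n =>
  v n * (log_kernel N (m * n) - log_kernel N (m.+1 * n))%:C%C)); last first.
  by move=> n _; rewrite rmorphB /= mulrBr.
rewrite -/(psum (fun n =>
  v n * (log_kernel N (m * n) - log_kernel N (m.+1 * n))%:C%C) N).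
rewrite psum_abel !log_kernel_gt ?N0 /=.
- rewrite subrr mulr0 addr0 mulr_sumr; apply: eq_bigr => n _.
  by rewrite mulrA -rmorphB.
- by rewrite mulSn ltnW // leq_addr.
- by rewrite ltnW // leq_pmull.
Qed.

(* Both series may converge only conditionally: their Dirichlet product is
   summable by logarithmic means, because convexity of the kernel makes the
   weights obtained by a double Abel summation nonnegative. *)
Lemma log_sum_cvg u v (lu lv : R[i]) : (psum u @ \oo --> lu)%classic ->
  (psum v @ \oo --> lv)%classic ->
  ((fun N => log_sum u v N / (ln N%:R)%:C%C) @ \oo --> lu * lv)%classic.
Proof.
move=> hu hv; have [Mv Mv0 vM] := cvg_cabs_bounded hv.
(* These bound the two parts of [(psum u m - lu) * psum v n + lu * (psum v n - lv)]; the first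
   depends only on [m] and the second only on [n]. *)
pose p n := cabs (psum u n - lu) * Mv.
pose q n := cabs lu * cabs (psum v n - lv).
have p0 n : 0 <= p n by rewrite mulr_ge0 ?cabs_ge0.
have q0 n : 0 <= q n by rewrite mulr_ge0 ?cabs_ge0.
have pc : (p @ \oo --> (0 : R))%classic.
  have := cvgM (proj1 (cvg_cabs _ _) hu) (cvg_cst Mv).
  rewrite mul0r; exact.
have qc : (q @ \oo --> (0 : R))%classic.
  have := cvgM (cvg_cst (cabs lu)) (proj1 (cvg_cabs _ _) hv).
  rewrite mulr0; exact.
have pqc := cvgD (log_cesaro p0 pc) (log_cesaro q0 qc); rewrite addr0 in pqc.
apply/cvg_cabs; apply: squeeze_cvgr (cvg_cst (0 : R)) (pqc _).
near=> N; rewrite cabs_ge0 /=.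
have N1 : (1 < N)%N by near: N; exact: nbhs_infty_gt.
have N0 : (0 < N)%N by exact: ltnW.
have lN : 0 < ln N%:R :> R by rewrite ln_gt0 // ltr1n.
have step m : (0 < m < N.+1)%N ->
    psum (log_weight N m) N = if (m < N)%N then log_step m else 0.
  move=> /andP[m0]; rewrite ltnS => mN; rewrite log_weight_sum ?m0 //.
  case: ltnP => mN'.
    rewrite (@log_kernel_le N m) ?m0 // (@log_kernel_le N m.+1) //.
    by rewrite /log_step opprB addrC addrA subrK.
  by rewrite !log_kernel_gt ?N0 // ?subrr // ltnW.
have wsum (f : nat -> R) :
    \sum_(1 <= m < N.+1) \sum_(1 <= n < N.+1) f m * log_weight N m n =
    \sum_(1 <= m < N) f m * log_step m.
  rewrite [RHS](@big_nat_widen _ _ _ _ _ N.+1) // [RHS]big_mkcond /=.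
  apply: eq_big_nat => m mN; rewrite -mulr_sumr -/(psum _ N) step //.
  by case: ifP; rewrite ?mulr0.
(* Since the weights have total mass [ln N], the limit [lu * lv] can be subtracted inside the
   weighted double sum. *)
have tot : \sum_(1 <= m < N.+1) \sum_(1 <= n < N.+1) log_weight N m n = ln N%:R.
  have := wsum (fun=> 1); under eq_bigr do under eq_bigr do rewrite mul1r.
  by move->; under eq_bigr do rewrite mul1r; rewrite log_step_sum // ln1 subr0.
rewrite -[leRHS]/((\sum_(1 <= m < N) p m * log_step m) / ln N%:R +
  (\sum_(1 <= m < N) q m * log_step m) / ln N%:R).
rewrite -mulrDl ler_pdivlMr // -[X in _ * X](cabs_real (ltW lN)) -cabsM mulrBl.
rewrite divfK; last by rewrite (inj_eq (@complexI R) _ 0) gt_eqF.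
rewrite log_sumE // -{1}tot rmorph_sum /= mulr_sumr -sumrB.
apply: le_trans (cabs_sum _ _ _) _.
rewrite -(wsum p) -(wsum q) [X in _ <= _ + X]exchange_big -big_split /=.
rewrite big_nat_cond [leRHS]big_nat_cond ler_sum // => m /andP[/andP[m0 _] _].
rewrite rmorph_sum /= mulr_sumr -sumrB; apply: le_trans (cabs_sum _ _ _) _.
rewrite -big_split /=.
rewrite big_nat_cond [leRHS]big_nat_cond ler_sum // => n /andP[/andP[n0 _] _].
rewrite (log_weightC N n) -mulrBl -mulrDl cabsM cabs_real ?log_weight_ge0 //.
rewrite ler_wpM2r ?log_weight_ge0 //.
have -> : psum u m * psum v n - lu * lv =
  (psum u m - lu) * psum v n + lu * (psum v n - lv) by ring.
apply: le_trans (cabsD _ _) _; rewrite !cabsM lerD2r ler_wpM2l ?cabs_ge0 //.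
Unshelve. all: by end_near. Qed.

(** Once [A] is centred at its limit, split at [N %/ M]: for smaller [d] the index [N %/ d] is at
    least [M] and [A] is close to [l], while larger [d] lie in the tail of an absolutely convergent
    series. *)
Lemma mertens_cvg (t A : nat -> R[i]) (y l : R[i]) :
  (psum t @ \oo --> y)%classic -> cvgn (psum (fun d => cabs (t d))) ->
  (A @ \oo --> l)%classic ->
  (psum (fun d => t d * A (N %/ d)%N) N @[N --> \oo] --> y * l)%classic.
Proof.
move=> ty tc Al; have [C C0 AC] := cvg_cabs_bounded Al.
pose W := psum (fun d => cabs (t d)).
suff : (psum (fun d => t d * (A (N %/ d)%N - l)) N @[N --> \oo] --> (0 : R[i]))%classic.
  move=> h; rewrite -[y * l]add0r.
  rewrite (_ : (fun N => psum (fun d => t d * A (N %/ d)%N) N) =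
    (fun N => psum (fun d => t d * (A (N %/ d)%N - l)) N + psum t N * l)).
    exact: cvgD h (cvgM ty (cvg_cst l)).
  apply/funext => N; rewrite /psum mulr_suml -big_split /=.
  by apply: eq_bigr => d _; ring.
pose p k := cabs (A k - l); pose B := C + cabs l.
have pB k : p k <= B.
  by apply: le_trans (cabsD _ _) _; rewrite cabsN lerD2r.
have B0 : 0 <= B by rewrite addr_ge0 ?cabs_ge0.
have Wnd : nondecreasing_seq W.
  apply/nondecreasing_seqP => n; rewrite /W /psum [leRHS]big_nat_recr //=.
  by rewrite lerDl cabs_ge0.
have W0 n : 0 <= W n by rewrite sumr_ge0 // => d _; exact: cabs_ge0.
have WL n : W n <= limn W by exact: nondecreasing_cvgn_le.
set L := limn W in WL; have L0 : 0 <= L by exact: le_trans (W0 0%N) (WL _).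
apply/cvg_cabs/cvgr0Pnorm_lt => e e0.
(* The increments in [L + 1] and [B + 1] keep the denominators positive when [L] or [B] is zero. *)
have e1 : 0 < e / 2 / (L + 1) by rewrite !divr_gt0 // ltr_wpDl.
have e2 : 0 < e / 2 / (B + 1) by rewrite !divr_gt0 // ltr_wpDl.
have /cvg_cabs/cvgr0Pnorm_lt/(_ _ e1)[M0 _ pM] := Al; set M := M0.+1.
have /cvgrPdist_lt/(_ _ e2)[J0 _ WJ] := tc; set J := J0.+1.
near=> N.
have MN : (J * M <= N)%N by near: N; exact: nbhs_infty_ge.
have JNM : (J <= N %/ M)%N by rewrite leq_divRL.
have NMN : (N %/ M <= N)%N by exact: leq_div.
rewrite subr0 ger0_norm ?cabs_ge0 //; apply: le_lt_trans (cabs_sum _ _ _) _.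
under eq_bigr do rewrite cabsM -/(p _).
rewrite (@big_cat_nat _ _ _ (N %/ M).+1) //= [ltRHS]splitr.
apply: (@le_lt_trans _ _ (L * (e / 2 / (L + 1)) + B * (e / 2 / (B + 1)))); last first.
  have half (x : R) : 0 <= x -> x * (e / 2 / (x + 1)) < e / 2.
    move=> x0; rewrite mulrA ltr_pdivrMr ?ltr_wpDl // mulrC ltr_pM2l ?ltrDl //.
    by rewrite divr_gt0.
  by rewrite ltrD ?half.
apply: lerD.
  apply: le_trans (_ : W (N %/ M)%N * (e / 2 / (L + 1)) <= _); last first.
    by rewrite ler_wpM2r // ltW.
  rewrite /W /psum mulr_suml big_nat_cond [leRHS]big_nat_cond ler_sum //.
  move=> d /andP[/andP[d0 dN] _]; rewrite ler_wpM2l ?cabs_ge0 //.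
  have := pM (N %/ d)%N; rewrite /= ger0_norm ?cabs_ge0 // => h; apply/ltW/h.
  by rewrite ltnW // leq_divRL // mulnC -leq_divRL.
apply: le_trans (_ : (W N - W (N %/ M)%N) * B <= _).
  rewrite /W /psum [X in X - _](@big_cat_nat _ _ _ (N %/ M).+1) //= addrAC subrr add0r.
  by rewrite mulr_suml ler_sum // => d _; rewrite ler_wpM2l ?cabs_ge0.
rewrite mulrC ler_wpM2l //; apply: le_trans (_ : L - W (N %/ M)%N <= _).
  by rewrite lerD2r.
have := WJ (N %/ M)%N (ltnW JNM); rewrite /= => /ltW; apply: le_trans.
exact: ler_norm.
Unshelve. all: by end_near. Qed.

End LogMean.

(** * Convergence at the given point and the quadratic relation *)

Section DirichletSeries.
Variable R : realType.
Implicit Types (c : nat -> R[i]) (s : R[i]).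

Lemma dirichlet_psumE c s :
  dirichlet_psum c s = psum (fun n => c n * npow_neg n s).
Proof. by rewrite psumE. Qed.

Lemma cvg_dirichlet c s : (abscissa_cc c < (complex.Re s)%:E)%E ->
  cvgn (dirichlet_psum c s).
Proof.
move=> /ereal_inf_lt[_ [s0 cs0 <-]]; rewrite lte_fin => s0s.
exact: cvg_dirichlet_psum s0s cs0.
Qed.

Lemma cvg_psum_cabs_npow_neg s : 1 < complex.Re s ->
  cvgn (psum (fun n => cabs (npow_neg n s))).
Proof.
move=> s1; rewrite psumE; under eq_fun do rewrite cabs_npow_neg.
exact: cvg_rpow_neg.
Qed.

End DirichletSeries.

Theorem theorem10p2 (R : realType) (b : nat -> int)
  (hb0 : b 0%N = 1) (hb1 : b 1%N = 1)
  (hb : forall n : nat, (2 <= n)%N ->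
          b n + \sum_(1 <= i < n) b i * b (n - i)%N = 0)
  (s : R[i])
  (hs1 : 1 < complex.Re s)
  (hsc : (abscissa_cc (fun n => (a_coef b n)%:~R) < (complex.Re s)%:E)%E) :
  let phi := dirichlet (fun n => (a_coef b n)%:~R) s in
  let z := zeta s in
  (z - 1) * phi ^+ 2 + z * phi - z * (z - 1) = 0.
Proof.
move=> phi z.
(* The terms at [s] of zeta, [phi], [y = zeta - 1] and [y * phi + zeta], in this order. *)
pose zs n : R[i] := npow_neg n s.
pose as_ n : R[i] := (a_coef b n)%:~R * zs n.
pose ys n : R[i] := (1 < n)%N%:R * zs n.
pose ps n : R[i] :=
  (\sum_(2 <= d < n.+1 | (d %| n)%N) a_coef b (n %/ d) + 1)%:~R * zs n.
have zabs := cvg_psum_cabs_npow_neg hs1.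
have cz : (psum zs @ \oo --> z)%classic.
  rewrite /z /zeta /dirichlet (_ : dirichlet_psum (fun=> 1) s = psum zs).
    by rewrite psumE; apply: cabs_series_cvg; move: zabs; rewrite psumE.
  by rewrite dirichlet_psumE; apply/funext => n; apply: eq_bigr => m _; rewrite mul1r.
have ca : (psum as_ @ \oo --> phi)%classic.
  by have := cvg_dirichlet hsc; rewrite /phi /dirichlet dirichlet_psumE.
have cy : (psum ys @ \oo --> z - 1)%classic.
  apply/cvg_cabs/cvgr0Pnorm_lt => e e0.
  have /cvg_cabs/cvgr0Pnorm_lt/(_ _ e0)[M _ zM] := cz.
  exists M.+1 => // -[|n] //= Mn; rewrite (_ : psum ys n.+1 = psum zs n.+1 - 1).
    by rewrite opprB addrA subrK; apply: zM; exact: ltnW.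
  rewrite /psum [LHS]big_ltn // [X in _ = X - 1]big_ltn // [ys 1%N]mul0r add0r.
  rewrite [zs 1%N]npow_neg1 addrAC subrr add0r.
  by apply: eq_big_nat => m /andP[m1 _]; rewrite /ys m1 mul1r.
have yabs : cvgn (psum (fun d => cabs (ys d))).
  rewrite psumE; apply: (@series_le_cvg _ _ (fun k => cabs (zs k.+1))) => [n|n|n|].
  - exact: cabs_ge0.
  - exact: cabs_ge0.
  - rewrite /ys; case: (1 < n.+1)%N; first by rewrite mul1r.
    by rewrite mul0r cabs0 cabs_ge0.
  - by move: zabs; rewrite psumE.
(* Grouping the partial sums of [y * phi] by the divisor [d] gives the form of [mertens_cvg], where
   only [y] has to converge absolutely. *)
have cp : (psum ps @ \oo --> (z - 1) * phi + z)%classic.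
  rewrite (_ : psum ps = (fun N =>
    psum (fun d => ys d * psum as_ (N %/ d)%N) N + psum zs N)).
    exact: cvgD (mertens_cvg cy yabs ca) cz.
  apply/funext => N.
  transitivity (\sum_(2 <= d < N.+1) ys d * psum as_ (N %/ d)%N + psum zs N); last first.
    congr (_ + _); case: N => [|N]; first by rewrite /psum !big_geq.
    by rewrite [RHS]big_ltn // [ys 1%N]mul0r mul0r add0r.
  rewrite [in RHS](eq_big_nat _ _
    (F2 := fun d => \sum_(1 <= m < (N %/ d).+1) ys d * as_ m)); last first.
    by move=> d _; rewrite mulr_sumr.
  rewrite -(@sum_divisors _ N (fun d m => ys d * as_ m)) -big_split /=.
  apply: eq_big_nat => n /andP[n0 _]; rewrite /ps rmorphD rmorph_sum /= mulrDl mul1r.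
  congr (_ + _); rewrite mulr_suml; apply: congr_big_nat => // d /andP[dn /andP[d2 _]].
  have d0 : (0 < d)%N by exact: ltnW.
  rewrite /ys d2 mul1r /as_ mulrCA -npow_negM //; first by rewrite mulnC divnK.
  by rewrite divn_gt0 // dvdn_leq.
have lim1 := log_sum_cvg cp ca.
have lim2 := log_sum_cvg cz cy.
(* Equal Dirichlet product coefficients give equal means for every [N]; uniqueness of limits then
   yields [((z - 1) * phi + z) * phi = z * (z - 1)]. *)
suff E : (fun N => log_sum ps as_ N / (ln N%:R)%:C%C) =
         (fun N => log_sum zs ys N / (ln N%:R)%:C%C).
  rewrite E in lim1; have := norm_cvg_unique lim1 lim2 => h.
  rewrite -[RHS](subrr (z * (z - 1))) -{2}h; ring.
apply/funext => N; congr (_ / _); case: N => [|N]; first by rewrite /log_sum !big_geq.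
(* As n^(-s) is multiplicative, the powers and the kernel combine into a test function of [m * n]
   alone, and the kernel makes it vanish above [N.+1]. *)
pose g n : R[i] := zs n * (log_kernel R N.+1 n)%:C%C.
have gN : vanish_above N.+1 g.
  by move=> n nN; rewrite /g log_kernel_gt ?mulr0 //= ltnW.
transitivity (\sum_(1 <= m < N.+2) \sum_(1 <= n < N.+2)
    (\sum_(2 <= d < m.+1 | (d %| m)%N) a_coef b (m %/ d) + 1)%:~R *
    (a_coef b n)%:~R * g (m * n)%N).
  apply: eq_big_nat => m /andP[m0 _]; apply: eq_big_nat => n /andP[n0 _].
  by rewrite /ps /as_ /g /zs npow_negM //; ring.
rewrite (pairing_identity hb1 hb) //.
apply: eq_big_nat => m /andP[m0 _]; apply: eq_big_nat => n /andP[n0 _].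
by rewrite /ys /g /zs npow_negM //; ring.
Qed.
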